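(* Let $\nu\in\mathbb{R}\setminus\{0\}$ and $a\in\mathbb{R}$. Let $\Phi$ be identically equal to $1$, $F(V)=\nu$ for all $V\in\mathbb{R}$, and $h(x)=\frac{\nu}{2}x^2+ax$ for $x\ge0$. For the solution $$u_0(x,t)=\int_0^{+\infty}G(x,t,\xi,0)h(\xi)\,d\xi$$ to Problem P$_0$ we have $$\lim_{t\to+\infty}u_0(x,t)=\infty\qquad\forall\,x>0.$$ Furthermore, there exists a solution $u$ to Problem P such that $$\lim_{t\to+\infty}u(x,t)=h(x)\qquad\forall\,x>0.$$
   Context: Problem P: $u_t(x,t)-u_{xx}(x,t)=-\Phi(x)F(u_x(0,t))$ for $x>0,t>0$; $u(x,0)=h(x)$ for $x>0$; $u(0,t)=0$ for $t>0$. Problem P$_0$ is the same problem without source term: $u_t-u_{xx}=0$ for $x>0,t>0$; $u(x,0)=h(x)$ for $x>0$; $u(0,t)=0$ for $t>0$. The Green function is $G(x,t,\xi,\tau)=K(x,t,\xi,\tau)-K(-x,t,\xi,\tau)$ with $K(x,t,\xi,\tau)=\frac{1}{2\sqrt{\pi(t-\tau)}}\exp\big(-(x-\xi)^2/(4(t-\tau))\big)$. The symbol $\infty$ (without sign) means divergence to infinity in absolute value: $|u_0(x,t)|\to+\infty$. *)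

(* Defs.v *)
From HB Require Import structures.
From mathcomp Require Import all_boot all_order all_algebra.
From mathcomp Require Import all_classical all_reals all_analysis.

Set Implicit Arguments.
Unset Strict Implicit.
Unset Printing Implicit Defensive.

Import Order.TTheory GRing.Theory Num.Theory.
Import numFieldNormedType.Exports.
Local Open Scope classical_set_scope.
Local Open Scope ring_scope.

Section NonclassicalHeat.
Context {R : realType}.

Definition K (x t xi tau : R) : R :=
  (2 * Num.sqrt (pi * (t - tau)))^-1
  * expR (- ((x - xi) ^+ 2 / (4 * (t - tau)))).

Definition G (x t xi tau : R) : R := K x t xi tau - K (- x) t xi tau.

Definition open_quadrant : set (R * R) := [set p | 0 < p.1 /\ 0 < p.2].

(* The corner is removed: the data need not satisfy h(0) = 0. *)
Definition closed_quadrant_minus_corner : set (R * R) :=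
  [set p | [/\ 0 <= p.1, 0 <= p.2 & p != (0, 0)]].

(* A function u(x, t) is curried with space first: u x is the function of time
   and u ^~ t the function of space. *)
Definition d_t (u : R -> R -> R) (x t : R) : R := derive1 (u x) t.
Definition d_x (u : R -> R -> R) (x t : R) : R := derive1 (u ^~ t) x.
Definition d_xx (u : R -> R -> R) (x t : R) : R := derive1 (d_x u ^~ t) x.

(* u is C^{2,1} in the open quadrant, attains its initial and boundary values
   continuously, and solves u_t - u_xx = q, u(x,0) = h(x), u(0,t) = 0. *)
Record heat_solution (q : R -> R -> R) (h : R -> R) (u : R -> R -> R) : Prop :=
  HeatSolution {
    heat_continuous :
      {within closed_quadrant_minus_corner, continuous (fun p => u p.1 p.2)} ;
    heat_derivable_t :
      forall x t, 0 < x -> 0 < t -> derivable (u x) t 1 ;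
    heat_derivable_x :
      forall x t, 0 < x -> 0 < t -> derivable (u ^~ t) x 1 ;
    heat_derivable_xx :
      forall x t, 0 < x -> 0 < t -> derivable (d_x u ^~ t) x 1 ;
    heat_continuous_t :
      {within open_quadrant, continuous (fun p => d_t u p.1 p.2)} ;
    heat_continuous_x :
      {within open_quadrant, continuous (fun p => d_x u p.1 p.2)} ;
    heat_continuous_xx :
      {within open_quadrant, continuous (fun p => d_xx u p.1 p.2)} ;
    heat_equation :
      forall x t, 0 < x -> 0 < t -> d_t u x t - d_xx u x t = q x t ;
    heat_initial : forall x, 0 < x -> u x 0 = h x ;
    heat_boundary : forall t, 0 < t -> u 0 t = 0
  }.

(* u_x(0, t) is the one-sided derivative, the material being x > 0. *)
Definition boundary_flux_quotient (u : R -> R -> R) (t : R) : R -> R :=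
  fun x => (u x t - u 0 t) / x.

Definition boundary_flux (u : R -> R -> R) (t : R) : R :=
  lim (boundary_flux_quotient u t x @[x --> 0^'+]).

Definition solution_P (Phi F h : R -> R) (u : R -> R -> R) : Prop :=
  (forall t, 0 < t -> cvg (boundary_flux_quotient u t x @[x --> 0^'+])) /\
  heat_solution (fun x t => - Phi x * F (boundary_flux u t)) h u.

Definition solution_P0 (h : R -> R) (u : R -> R -> R) : Prop :=
  heat_solution (fun _ _ => 0) h u.

(* The kernel degenerates to a Dirac mass at t = 0, so there the integral is
   replaced by the initial datum. *)
Definition green_solution (h : R -> R) (x t : R) : R :=
  if 0 < t then
    \int[lebesgue_measure]_(xi in `[0, +oo[) (G x t xi 0 * h xi)
  else h x.

End NonclassicalHeat.

(* Main.v *)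
Require Import Defs.
From HB Require Import structures.
From mathcomp Require Import all_boot all_order all_algebra.
From mathcomp Require Import all_classical all_reals all_analysis.
From mathcomp Require Import measurable_realfun ring lra.

Set Implicit Arguments.
Unset Strict Implicit.
Unset Printing Implicit Defensive.

Import Order.TTheory GRing.Theory Num.Theory.
Import numFieldNormedType.Exports.
Local Open Scope classical_set_scope.
Local Open Scope ring_scope.

(* In xi, the products of K(x, t, xi, 0) with xi and xi^2 have explicit
   antiderivatives built from K and erf, and the reflected kernel G is
   nonnegative for x, xi >= 0, so the fundamental theorem of calculus on
   [0, +oo[ gives, for t > 0 and g = exp(-x^2 / (4t)),
     u0(x, t) = nu/2 ((x^2 + 2t) erf(x / (2 sqrt t)) + 2 x sqrt(t/pi) g) + a x.
   Then (u0)_x = nu (x erf(x / (2 sqrt t)) + 2 sqrt(t/pi) g) + a and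
   (u0)_xx = (u0)_t = nu erf(x / (2 sqrt t)). Both terms in the bracket of u0
   are nonnegative, and the second one grows like sqrt t. For Problem P the
   datum itself, extended as a polynomial, is a stationary solution. *)

(** * Differentiation rules for functions of one real variable *)

Section RealDerivatives.
Context {R : realType}.
Implicit Types (f g : R -> R) (c x df dg : R).

Lemma is_derive_const c x : is_derive x 1 (fun _ : R => c) 0.
Proof. exact: is_derive_cst. Qed.

Lemma is_derive_var x : is_derive x 1 (fun y : R => y) 1.
Proof. exact: is_derive_id. Qed.

(** With the functions under explicit binders, the derivative of a long formula can be assembled as
    one term that follows the shape of the formula; a final [field] or [ring] then simplifies the
    value. *)
Lemma is_derive_add f g x df dg :
  is_derive x 1 f df -> is_derive x 1 g dg ->
  is_derive x 1 (fun y => f y + g y) (df + dg).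
Proof. by move=> ? ?; exact: is_deriveD. Qed.

Lemma is_derive_mul f g x df dg :
  is_derive x 1 f df -> is_derive x 1 g dg ->
  is_derive x 1 (fun y => f y * g y) (df * g x + f x * dg).
Proof.
move=> Df Dg; apply: (is_derive_eq (is_deriveM Df Dg)).
by rewrite /GRing.scale /=; ring.
Qed.

Lemma is_derive_comp f g x df dg :
  is_derive (g x) 1 f df -> is_derive x 1 g dg ->
  is_derive x 1 (fun y => f (g y)) (df * dg).
Proof. exact: is_derive1_comp. Qed.

Lemma is_derive_divc c x : is_derive x 1 (fun y => y / c) c^-1.
Proof.
apply: (is_derive_eq (is_derive_mul (is_derive_var _) (is_derive_const _ _))).
by rewrite mulr0 addr0 mul1r.
Qed.

Lemma is_derive_sqr x : is_derive x 1 (fun y => y ^+ 2) (2 * x).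
Proof.
have -> : (fun y : R => y ^+ 2) = (fun y => y * y) by apply/funext => y; rewrite expr2.
apply: (is_derive_eq (is_derive_mul (is_derive_var _) (is_derive_var _))).
by rewrite /=; ring.
Qed.

Lemma is_derive_continuous f x df : is_derive x 1 f df -> {for x, continuous f}.
Proof.
by move=> ?; apply: differentiable_continuous; apply/derivable1_diffP.
Qed.

Lemma is_derive_gauss x : is_derive x 1 (@gauss_fun R) (- (2 * x) * gauss_fun x).
Proof.
apply: (is_derive_eq
  (is_derive_comp (is_derive_expR _) (is_deriveN (is_derive_sqr x)))).
by rewrite mulrC.
Qed.

Lemma gauss_funN x : gauss_fun (- x) = gauss_fun x :> R.
Proof. by rewrite /gauss_fun sqrrN. Qed.

End RealDerivatives.

(** * The error function: derivative, parity, sign and limit at infinity *)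

Section ErrorFunction.
Context {R : realType}.
Implicit Types x y : R.
Let mu := @lebesgue_measure R.

Let gauss_int x := \int[mu]_(t in `]-oo, x]) gauss_fun t.

(** A difference of integrals from minus infinity makes sense for both signs of [x] and can be
    differentiated at every real point by the fundamental theorem of calculus. *)
Definition erf x := 2 / Num.sqrt pi * (gauss_int x - gauss_int 0).

Lemma erf0 : erf 0 = 0.
Proof. by rewrite /erf subrr mulr0. Qed.

Lemma sqrtpi_gt0 : 0 < Num.sqrt (pi : R).
Proof. by rewrite sqrtr_gt0 pi_gt0. Qed.

Let integrable_gauss (D : set R) : measurable D ->
  mu.-integrable D (EFin \o gauss_fun).
Proof. by move=> mD; apply: integrableS integrableT_gauss. Qed.

Lemma is_derive_erf x : is_derive x 1 erf (2 / Num.sqrt pi * gauss_fun x).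
Proof.
have D : is_derive x 1 gauss_int (gauss_fun x).
  (* The right end [x + 1] only serves to make [x] an interior point. *)
  have [] := @continuous_FTC1 R gauss_fun -oo%O x (x + 1).
  - by rewrite ltrDl.
  - exact: integrable_gauss.
  - by rewrite ltNyr.
  - exact: continuous_gauss_fun.
  by move=> d <-; rewrite derive1E; exact: derivableP.
apply: (is_derive_eq (is_derive_mul (is_derive_const _ _)
  (is_derive_add D (is_derive_const _ _)))).
by rewrite /= mul0r add0r addr0.
Qed.

(** Since [gauss_fun] is even, [erf (- y) + erf y] has derivative 0 in [y], hence keeps its value at
    0. *)
Lemma erfN x : erf (- x) = - erf x.
Proof.
apply/eqP; rewrite -subr_eq0 opprK; apply/eqP.
transitivity (erf (- 0) + erf 0); last by rewrite oppr0 erf0 addr0.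
apply: (@is_derive_0_is_cst R (fun y => erf (- y) + erf y)) => y.
apply: (is_derive_eq (is_derive_add
  (is_derive_comp (is_derive_erf _) (is_deriveNid y 1)) (is_derive_erf y))).
by rewrite gauss_funN; ring.
Qed.

Lemma erf_itv x : 0 <= x ->
  erf x = 2 / Num.sqrt pi * \int[mu]_(t in `[0, x]) gauss_fun t.
Proof.
move=> x0; rewrite /erf -(Rintegral_itv_obnd_cbnd (r := 0)); last first.
  exact: integrable_gauss.
congr (_ * _); apply: Rintegral_itvB => //.
exact: integrable_gauss.
Qed.

Lemma erf_ge0 x : 0 <= x -> 0 <= erf x.
Proof.
move=> x0; rewrite erf_itv// mulr_ge0 ?divr_ge0 ?sqrtr_ge0//.
by apply: Rintegral_ge0 => t _; exact: gauss_fun_ge0.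
Qed.

(** The Gaussian integral enters as a limit of squares, equal to pi / 4; the integrals being
    nonnegative, square roots give sqrt(pi) / 2, which the factor of [erf] normalizes to 1. *)
Lemma cvg_erfy : erf x @[x --> +oo] --> (1 : R).
Proof.
have I : Num.sqrt (gauss_integral_proof.integral0_gauss x ^+ 2) @[x --> +oo]
    --> Num.sqrt (pi / 4 : R).
  by apply: continuous_cvg; [exact: sqrt_continuous|
    exact: gauss_integral_proof.cvg_integral0_gauss_sqr].
have E : 2 / Num.sqrt pi * Num.sqrt (pi / 4 : R) = 1.
  rewrite sqrtrM ?pi_ge0// sqrtrV// (_ : 4 = 2 ^+ 2); last by ring.
  rewrite sqrtr_sqr ger0_norm//.
  by field; rewrite gt_eqF// sqrtpi_gt0.
rewrite -[X in _ --> X]E.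
have : 2 / Num.sqrt pi * Num.sqrt (gauss_integral_proof.integral0_gauss x ^+ 2)
    @[x --> +oo] --> 2 / Num.sqrt pi * Num.sqrt (pi / 4 : R).
  by apply: cvgM => //; exact: cvg_cst.
apply: cvg_trans; apply: near_eq_cvg; near=> x.
rewrite sqrtr_sqr ger0_norm ?gauss_integral_proof.integral0_gauss_ge0//.
by rewrite erf_itv.
Unshelve. all: by end_near. Qed.

(** Squeezed between 0 and 1 / x, because x^2 <= 1 + x^2 <= exp(x^2). *)
Lemma cvg_mul_gauss : x * gauss_fun x @[x --> +oo] --> (0 : R).
Proof.
apply: (@squeeze_cvgr _ _ _ _ (cst 0) (fun x => x^-1)).
- near=> x; have x0 : 0 < x by near: x; exact: nbhs_pinfty_gt.
  rewrite mulr_ge0 ?gauss_fun_ge0 ?(ltW x0)//=.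
  rewrite /gauss_fun expRN ler_pdivrMr ?expR_gt0//.
  rewrite mulrC ler_pdivlMr// -expr2 (le_trans _ (expR_ge1Dx _))// lerDr//.
- exact: cvg_cst.
- apply/gtr0_cvgV0; last exact: cvg_id.
  exact: nbhs_pinfty_gt.
Unshelve. all: by end_near. Qed.

End ErrorFunction.

(** * First and second moments of the reflected heat kernel on the half-line *)

Section HeatKernelMoments.
Context {R : realType}.
(* [s] stands for sqrt t, so that no square root has to be differentiated. *)
Variables (s : R) (s_gt0 : 0 < s).
Implicit Types c x xi : R.
Let mu := @lebesgue_measure R.

Let s_neq0 : s != 0. Proof. by rewrite gt_eqF. Qed.
Let sqrtpi_neq0 : Num.sqrt pi != 0 :> R. Proof. by rewrite gt_eqF ?sqrtpi_gt0. Qed.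

(** As a function of [xi], the normal density with mean [c] and variance 2 s^2. *)
Definition heat_kernel c xi := (2 * s * Num.sqrt pi)^-1 * gauss_fun ((xi - c) / (2 * s)).

(** The normal distribution function lowered by 1/2, hence odd about [c]. *)
Let kernel_cdf c xi := erf ((xi - c) / (2 * s)) / 2.

Let is_derive_affine c xi : is_derive xi 1 (fun y => (y - c) / (2 * s)) (2 * s)^-1.
Proof.
apply: (is_derive_eq (is_derive_comp (is_derive_divc (2 * s) _)
  (is_derive_add (is_derive_var _) (is_derive_const _ _)))).
by rewrite addr0 mulr1.
Qed.

Let is_derive_kernel c xi :
  is_derive xi 1 (heat_kernel c) (- (xi - c) / (2 * s ^+ 2) * heat_kernel c xi).
Proof.
apply: (is_derive_eq (is_derive_mul (is_derive_const _ _)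
  (is_derive_comp (is_derive_gauss _) (is_derive_affine c xi)))).
by rewrite /heat_kernel; field; rewrite sqrtpi_neq0 s_neq0.
Qed.

Let is_derive_kernel_cdf c xi : is_derive xi 1 (kernel_cdf c) (heat_kernel c xi).
Proof.
apply: (is_derive_eq (is_derive_comp (is_derive_divc 2 _)
  (is_derive_comp (is_derive_erf _) (is_derive_affine c xi)))).
by rewrite /heat_kernel; field; rewrite sqrtpi_neq0 s_neq0.
Qed.

Let cvg_affine c : (xi - c) / (2 * s) @[xi --> +oo] --> +oo.
Proof.
apply/cvgryPge => M; near=> xi.
rewrite ler_pdivlMr ?mulr_gt0// lerBrDr.
by near: xi; apply: nbhs_pinfty_ge; exact: num_real.
Unshelve. all: by end_near. Qed.

Let cvg_kernel_cdf c : kernel_cdf c xi @[xi --> +oo] --> (1 / 2 : R).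
Proof.
exact: (cvgM (cvg_comp _ _ (cvg_affine c) cvg_erfy) (cvg_cst _)).
Qed.

Let cvg_kernel c : heat_kernel c xi @[xi --> +oo] --> (0 : R).
Proof.
rewrite -(mulr0 (2 * s * Num.sqrt pi)^-1).
exact: (cvgM (cvg_cst _) (cvg_comp _ _ (cvg_affine c) cvg_gauss_fun)).
Qed.

Let cvg_mul_kernel c : xi * heat_kernel c xi @[xi --> +oo] --> (0 : R).
Proof.
(* Splitting [xi] as [(xi - c) + c] brings out the argument of the Gaussian as a factor. *)
have -> : (fun xi => xi * heat_kernel c xi) = (fun xi => (Num.sqrt pi)^-1 *
    ((xi - c) / (2 * s) * gauss_fun ((xi - c) / (2 * s))) + c * heat_kernel c xi).
  apply/funext => xi; rewrite /heat_kernel; field.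
  by rewrite sqrtpi_neq0 s_neq0.
rewrite -[X in _ --> X](addr0 0); apply: cvgD; last first.
  by rewrite -(mulr0 c); apply: cvgM; [exact: cvg_cst|exact: cvg_kernel].
rewrite -(mulr0 (Num.sqrt pi)^-1).
exact: (cvgM (cvg_cst _) (cvg_comp _ _ (cvg_affine c) cvg_mul_gauss)).
Qed.

Let kernel0N x : heat_kernel (- x) 0 = heat_kernel x 0.
Proof. by rewrite /heat_kernel !sub0r opprK mulNr gauss_funN. Qed.

Let kernel_cdf0N x : kernel_cdf (- x) 0 = - kernel_cdf x 0.
Proof. by rewrite /kernel_cdf !sub0r opprK mulNr erfN mulNr opprK. Qed.

(** The point [xi] is at least as close to [x] as to [- x]: (xi + x)^2 - (xi - x)^2 = 4 x xi. *)
Let kernelB_ge0 x xi : 0 <= x -> 0 <= xi -> 0 <= heat_kernel x xi - heat_kernel (- x) xi.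
Proof.
move=> x0 xi0; rewrite /heat_kernel -mulrBr mulr_ge0//.
  by rewrite invr_ge0 !mulr_ge0 ?sqrtr_ge0// ltW.
rewrite subr_ge0 /gauss_fun ler_expR lerN2 !expr_div_n.
rewrite ler_pM2r ?invr_gt0 ?exprn_gt0 ?mulr_gt0// opprK.
by rewrite -subr_ge0 (_ : _ - _ = 4 * (x * xi)); [rewrite !mulr_ge0|ring].
Qed.

(** Nonnegativity allows the fundamental theorem on an unbounded interval, and turns the finite
    value of the integral into integrability, as [f] equals its absolute value there. *)
Let moment_via_FTC (f F : R -> R) (l : R) :
  (forall xi, 0 <= xi -> 0 <= f xi) -> continuous f ->
  (forall xi, is_derive xi 1 F (f xi)) -> F xi @[xi --> +oo] --> l ->
  (\int[mu]_(xi in `[0%R, +oo[) (f xi)%:E = (l - F 0)%R%:E)%E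
  /\ mu.-integrable `[0, +oo[ (EFin \o f).
Proof.
move=> f0 cf dF Fl.
have I : (\int[mu]_(xi in `[0%R, +oo[) (f xi)%:E = (l - F 0)%R%:E)%E.
  apply: ge0_continuous_FTC2y => //.
  - exact: continuous_subspaceT.
  - by apply: cvg_at_right_filter; exact: is_derive_continuous.
  - by move=> xi _; rewrite derive1E; exact: derive_val.
split => //; apply/integrableP; split.
  by apply/measurable_EFinP/measurable_funTS; exact: continuous_measurable_fun.
apply: le_lt_trans (ltry (l - F 0)); rewrite -I le_eqVlt; apply/orP; left.
apply/eqP; apply: eq_integral => xi.
by rewrite inE /= in_itv/= andbT => xi0; rewrite ger0_norm ?f0.
Qed.

Let continuous_kernelB x : continuous (fun xi => heat_kernel x xi - heat_kernel (- x) xi).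
Proof. by move=> xi; apply: cvgB; apply: is_derive_continuous. Qed.

(** For the kernel k centred at c, k' = -(xi - c) k / (2 s^2), so xi k = c k - 2 s^2 k'. Taking the
    difference of the cases c = x and c = -x gives the antiderivative; it vanishes at 0 by
    reflection and tends to [x]. *)
Lemma kernel_moment1 x : 0 <= x ->
  (\int[mu]_(xi in `[0%R, +oo[)
     ((heat_kernel x xi - heat_kernel (- x) xi) * xi)%R%:E = x%:E)%E
  /\ mu.-integrable `[0, +oo[
       (fun xi => ((heat_kernel x xi - heat_kernel (- x) xi) * xi)%:E).
Proof.
move=> x0; have [||||I J] := @moment_via_FTC
  (fun xi => (heat_kernel x xi - heat_kernel (- x) xi) * xi)
  (fun xi => x * (kernel_cdf x xi + kernel_cdf (- x) xi)
    + - (2 * s ^+ 2) * (heat_kernel x xi + - 1 * heat_kernel (- x) xi)) x.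
- by move=> xi xi0; rewrite mulr_ge0// kernelB_ge0.
- by move=> xi; apply: cvgM; [exact: continuous_kernelB|exact: cvg_id].
- move=> xi; apply: (is_derive_eq (is_derive_add
    (is_derive_mul (is_derive_const _ _)
      (is_derive_add (is_derive_kernel_cdf x xi) (is_derive_kernel_cdf (- x) xi)))
    (is_derive_mul (is_derive_const _ _) (is_derive_add (is_derive_kernel x xi)
      (is_derive_mul (is_derive_const _ _) (is_derive_kernel (- x) xi)))))).
  by field.
- have E : x * (1 / 2 + 1 / 2) + - (2 * s ^+ 2) * (0 + - 1 * 0) = x by field.
  rewrite -[X in _ --> X]E; apply: cvgD; apply: cvgM; try exact: cvg_cst.
    by apply: cvgD; exact: cvg_kernel_cdf.
  by apply: cvgD; [|apply: cvgM; [exact: cvg_cst|]]; exact: cvg_kernel.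
- split => //; rewrite I kernel0N kernel_cdf0N; congr EFin; ring.
Qed.

(** Using the relation xi k = c k - 2 s^2 k' twice gives xi^2 k = (c^2 + 2 s^2) k - 2 s^2 (xi k + c
    k)'. The antiderivative for the difference of c = x and c = -x tends to 0, so the whole value
    comes from the endpoint 0. *)
Lemma kernel_moment2 x : 0 <= x ->
  (\int[mu]_(xi in `[0%R, +oo[)
     ((heat_kernel x xi - heat_kernel (- x) xi) * xi ^+ 2)%R%:E =
    ((x ^+ 2 + 2 * s ^+ 2) * erf (x / (2 * s)) + 4 * s ^+ 2 * x * heat_kernel x 0)%R%:E)%E
  /\ mu.-integrable `[0, +oo[
       (fun xi => ((heat_kernel x xi - heat_kernel (- x) xi) * xi ^+ 2)%:E).
Proof.
move=> x0; have [||||I J] := @moment_via_FTC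
  (fun xi => (heat_kernel x xi - heat_kernel (- x) xi) * xi ^+ 2)
  (fun xi => (x ^+ 2 + 2 * s ^+ 2) * (kernel_cdf x xi + -1 * kernel_cdf (- x) xi)
    + - (2 * s ^+ 2) * (xi * heat_kernel x xi + - 1 * (xi * heat_kernel (- x) xi)
                       + x * (heat_kernel x xi + heat_kernel (- x) xi))) 0.
- by move=> xi xi0; rewrite mulr_ge0 ?sqr_ge0// kernelB_ge0.
- move=> xi; apply: cvgM; [exact: continuous_kernelB|exact: exprn_continuous].
- move=> xi; apply: (is_derive_eq (is_derive_add
    (is_derive_mul (is_derive_const _ _)
      (is_derive_add (is_derive_kernel_cdf x xi)
        (is_derive_mul (is_derive_const _ _) (is_derive_kernel_cdf (- x) xi))))
    (is_derive_mul (is_derive_const _ _) (is_derive_add (is_derive_add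
      (is_derive_mul (is_derive_var _) (is_derive_kernel x xi))
      (is_derive_mul (is_derive_const _ _)
         (is_derive_mul (is_derive_var _) (is_derive_kernel (- x) xi))))
      (is_derive_mul (is_derive_const _ _)
         (is_derive_add (is_derive_kernel x xi) (is_derive_kernel (- x) xi))))))).
  by field.
- have E : (x ^+ 2 + 2 * s ^+ 2) * (1 / 2 + -1 * (1 / 2))
    + - (2 * s ^+ 2) * (0 + - 1 * 0 + x * (0 + 0)) = 0 by field.
  rewrite -[X in _ --> X]E; apply: cvgD; apply: cvgM; try exact: cvg_cst.
    apply: cvgD; first exact: cvg_kernel_cdf.
    by apply: cvgM; [exact: cvg_cst|exact: cvg_kernel_cdf].
  apply: cvgD; [apply: cvgD; [|apply: cvgM; [exact: cvg_cst|]]|].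
  + exact: cvg_mul_kernel.
  + exact: cvg_mul_kernel.
  + by apply: cvgM; [exact: cvg_cst|apply: cvgD; exact: cvg_kernel].
- split => //; rewrite I kernel0N kernel_cdf0N; congr EFin.
  by rewrite /kernel_cdf !sub0r [- x / _]mulNr erfN; field.
Qed.

End HeatKernelMoments.

(** * Closed form of the Green integral for the quadratic datum, and its derivatives *)

Section QuadraticDatum.
Context {R : realType}.
Implicit Types x t xi : R.
Let mu := @lebesgue_measure R.
Variables (nu a : R) (h : R -> R).
Hypothesis hE : forall x, 0 <= x -> h x = nu / 2 * x ^+ 2 + a * x.

Let sqrtpi_neq0 : Num.sqrt pi != 0 :> R. Proof. by rewrite gt_eqF ?sqrtpi_gt0. Qed.
Let sqrt_neq0 t : 0 < t -> Num.sqrt t != 0.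
Proof. by move=> t0; rewrite gt_eqF ?sqrtr_gt0. Qed.

Definition profile x t :=
  nu / 2 * ((x ^+ 2 + 2 * t) * erf (x / (2 * Num.sqrt t))
    + 2 / Num.sqrt pi * (x * Num.sqrt t) * gauss_fun (x / (2 * Num.sqrt t))) + a * x.

Definition profile_x x t :=
  nu * (x * erf (x / (2 * Num.sqrt t))
    + 2 / Num.sqrt pi * Num.sqrt t * gauss_fun (x / (2 * Num.sqrt t))) + a.

Definition profile_xx x t := nu * erf (x / (2 * Num.sqrt t)).

Lemma G_kernel x t xi : 0 < t ->
  G x t xi 0 = heat_kernel (Num.sqrt t) x xi - heat_kernel (Num.sqrt t) (- x) xi.
Proof.
move=> t0; suff KE c : K c t xi 0 = heat_kernel (Num.sqrt t) c xi by rewrite /G !KE.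
rewrite /K /heat_kernel subr0 sqrtrM ?pi_ge0// mulrA [2 * _ * _]mulrAC /gauss_fun.
congr (_ * expR (- _)); rewrite expr_div_n exprMn sqr_sqrtr ?(ltW t0)//.
by field; rewrite gt_eqF.
Qed.

Lemma profile_oddx x t : profile (- x) t = - profile x t.
Proof. by rewrite /profile mulNr erfN gauss_funN; ring. Qed.

Let integrandE x t xi : 0 < t -> 0 <= xi ->
  G x t xi 0 * h xi =
    nu / 2 * ((heat_kernel (Num.sqrt t) x xi
               - heat_kernel (Num.sqrt t) (- x) xi) * xi ^+ 2)
    + a * ((heat_kernel (Num.sqrt t) x xi
            - heat_kernel (Num.sqrt t) (- x) xi) * xi).
Proof. by move=> t0 xi0; rewrite G_kernel// hE//; ring. Qed.

(** The integrand is a linear combination of those of the two moments. Integrability ensures that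
    the real-valued integral in [green_solution] is not a default value. *)
Lemma integrable_green x t : 0 <= x -> 0 < t ->
  mu.-integrable `[0, +oo[ (fun xi => (G x t xi 0 * h xi)%:E).
Proof.
move=> x0 t0; have s0 : 0 < Num.sqrt t by rewrite sqrtr_gt0.
have [_ I1] := kernel_moment1 s0 x0; have [_ I2] := kernel_moment2 s0 x0.
have J1 := @integrableZl _ _ _ mu _ (measurable_itv _) a _ I1.
have J2 := @integrableZl _ _ _ mu _ (measurable_itv _) (nu / 2) _ I2.
move: (@integrableD _ _ _ mu _ (measurable_itv _) _ _ J2 J1).
apply: eq_integrable => // xi; rewrite inE /= in_itv/= andbT => xi0.
by rewrite integrandE.
Qed.

Lemma green_profile_ge0 x t : 0 <= x -> 0 < t -> green_solution h x t = profile x t.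
Proof.
move=> x0 t0; have s0 : 0 < Num.sqrt t by rewrite sqrtr_gt0.
have [E1 I1] := kernel_moment1 s0 x0; have [E2 I2] := kernel_moment2 s0 x0.
rewrite /green_solution t0.
rewrite (@eq_Rintegral _ _ _ mu _ (fun xi : R =>
    nu / 2 * ((heat_kernel (Num.sqrt t) x xi
               - heat_kernel (Num.sqrt t) (- x) xi) * xi ^+ 2)
    + a * ((heat_kernel (Num.sqrt t) x xi
            - heat_kernel (Num.sqrt t) (- x) xi) * xi))); last first.
  by move=> xi; rewrite inE /= in_itv/= andbT => xi0; exact: integrandE.
have J1 := @integrableZl _ _ _ mu _ (measurable_itv _) a _ I1.
have J2 := @integrableZl _ _ _ mu _ (measurable_itv _) (nu / 2) _ I2.
rewrite RintegralD//.
rewrite !RintegralZl// /Rintegral E1 E2 /= /profile sqr_sqrtr ?(ltW t0)//.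
congr (_ * (_ + _) + _).
rewrite /heat_kernel sub0r mulNr gauss_funN -{1}(sqr_sqrtr (ltW t0)).
by field; rewrite sqrtpi_neq0 sqrt_neq0.
Qed.

(** Both sides are odd in [x], which reduces negative [x] to the previous case. Equality on the
    whole line lets the function of [x] be replaced before it is differentiated. *)
Lemma green_profile x t : 0 < t -> green_solution h x t = profile x t.
Proof.
move=> t0; have [x0|x0] := leP 0 x; first exact: green_profile_ge0.
have Nx0 : 0 <= - x by rewrite oppr_ge0 ltW.
rewrite -[x in RHS]opprK profile_oddx -green_profile_ge0// /green_solution t0.
rewrite -mulN1r -RintegralZl//; last exact: integrable_green.
by apply: eq_Rintegral => xi _; rewrite /G opprK; ring.
Qed.

Let is_derive_scaled t x :
  is_derive x 1 (fun y => y / (2 * Num.sqrt t)) (2 * Num.sqrt t)^-1.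
Proof. exact: is_derive_divc. Qed.

(** The two terms in x^2 g / sqrt(t), one from differentiating [erf] and one from the Gaussian,
    cancel. *)
Lemma is_derive_profile_x x t : 0 < t ->
  is_derive x 1 (profile ^~ t) (profile_x x t).
Proof.
move=> t0; apply: (is_derive_eq (is_derive_add
  (is_derive_mul (is_derive_const (nu / 2) _) (is_derive_add
    (is_derive_mul (is_derive_add (is_derive_sqr _) (is_derive_const (2 * t) _))
       (is_derive_comp (is_derive_erf _) (is_derive_scaled t x)))
    (is_derive_mul (is_derive_mul (is_derive_const _ _)
         (is_derive_mul (is_derive_var _) (is_derive_const (Num.sqrt t) _)))
       (is_derive_comp (is_derive_gauss _) (is_derive_scaled t x)))))
  (is_derive_mul (is_derive_const a _) (is_derive_var x)))).
move: (sqrt_neq0 t0) (sqr_sqrtr (ltW t0)); rewrite /profile_x.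
(* Replacing [t] by [s ^+ 2] makes the identity rational in [s], with the values of [erf] and
   [gauss_fun] as atoms. *)
by move: (Num.sqrt t) => s s0 <-; field; rewrite sqrtpi_neq0 s0.
Qed.

Lemma is_derive_profile_xx x t : 0 < t ->
  is_derive x 1 (profile_x ^~ t) (profile_xx x t).
Proof.
move=> t0; apply: (is_derive_eq (is_derive_add
  (is_derive_mul (is_derive_const nu _) (is_derive_add
    (is_derive_mul (is_derive_var _)
       (is_derive_comp (is_derive_erf _) (is_derive_scaled t x)))
    (is_derive_mul (is_derive_const _ _)
       (is_derive_comp (is_derive_gauss _) (is_derive_scaled t x)))))
  (is_derive_const a _))).
rewrite /profile_xx.
by field; rewrite sqrtpi_neq0 sqrt_neq0.
Qed.

(** All Gaussian terms cancel, and what remains is the second space derivative: this is the heat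
    equation. *)
Lemma is_derive_profile_t x t : 0 < t ->
  is_derive t 1 (profile x) (profile_xx x t).
Proof.
move=> t0; have D2 : is_derive t 1 (fun s => 2 * Num.sqrt s) (Num.sqrt t)^-1.
  apply: (is_derive_eq (is_derive_mul (is_derive_const _ _) (is_derive1_sqrt t0))).
  by field; rewrite sqrt_neq0.
have DV : is_derive t 1 (fun s => x / (2 * Num.sqrt s)) (- x / (4 * Num.sqrt t ^+ 3)).
  have n0 : 2 * Num.sqrt t != 0 by rewrite mulf_neq0 ?sqrt_neq0.
  apply: (is_derive_eq (is_derive_mul (is_derive_const _ _)
    (is_deriveV (f := fun s => 2 * Num.sqrt s) n0 D2))).
  by rewrite /GRing.scale /=; field; rewrite sqrt_neq0.
apply: (is_derive_eq (is_derive_add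
  (is_derive_mul (is_derive_const (nu / 2) _) (is_derive_add
    (is_derive_mul (is_derive_add (is_derive_const (x ^+ 2) _)
       (is_derive_mul (is_derive_const 2 _) (is_derive_var _)))
       (is_derive_comp (is_derive_erf _) DV))
    (is_derive_mul (is_derive_mul (is_derive_const _ _)
         (is_derive_mul (is_derive_const x _) (is_derive1_sqrt t0)))
       (is_derive_comp (is_derive_gauss _) DV))))
  (is_derive_const (a * x) t))).
move: (sqrt_neq0 t0) (sqr_sqrtr (ltW t0)); rewrite /profile_xx.
by move: (Num.sqrt t) => s s0 <-; field; rewrite sqrtpi_neq0 s0.
Qed.

End QuadraticDatum.

(** Meant for [f] an explicit formula, continuous at the points of [A] in the ambient space, and [g]
    a derivative identified with it on [A]. *)
Lemma within_continuous_eq_in {T U : topologicalType} (A : set T) (f g : T -> U) :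
  (forall x, A x -> f x = g x) -> (forall x, A x -> {for x, continuous f}) ->
  {within A, continuous g}.
Proof.
move=> fg cf; apply/subspace_continuousP => x Ax.
rewrite /from_subspace -(fg x Ax).
have : f @ within A (nbhs x) --> f x by exact: cvg_within_filter (cf x Ax).
by apply: cvg_trans; apply: fmap_within_eq => y /set_mem Ay; rewrite fg.
Qed.

(** * Regularity of the Green integral up to the boundary, and its growth in time *)

Section QuadraticSolution.
Context {R : realType}.
Implicit Types (x t : R) (p : R * R).
Variables (nu a : R) (h : R -> R).
Hypothesis hE : forall x, 0 <= x -> h x = nu / 2 * x ^+ 2 + a * x.

Let cont_fst p : q.1 @[q --> p] --> p.1. Proof. exact: cvg_fst. Qed.
Let cont_snd p : q.2 @[q --> p] --> p.2. Proof. exact: cvg_snd. Qed.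

Let cont_fst_sqr p : q.1 ^+ 2 @[q --> p] --> p.1 ^+ 2.
Proof.
rewrite expr2; under eq_fun do rewrite expr2.
by apply: cvgM; exact: cont_fst.
Qed.

Let cont_sqrt p : Num.sqrt q.2 @[q --> p] --> Num.sqrt p.2.
Proof. by apply: continuous_cvg; [exact: sqrt_continuous|exact: cont_snd]. Qed.

Let cont_ratio p : 0 < p.2 ->
  q.1 / (2 * Num.sqrt q.2) @[q --> p] --> p.1 / (2 * Num.sqrt p.2).
Proof.
move=> p0; apply: cvgM; first exact: cont_fst.
apply: cvgV; first by rewrite mulf_neq0// gt_eqF// sqrtr_gt0.
by apply: cvgM; [exact: cvg_cst|exact: cont_sqrt].
Qed.

Let cont_erf_ratio p : 0 < p.2 ->
  erf (q.1 / (2 * Num.sqrt q.2)) @[q --> p] --> erf (p.1 / (2 * Num.sqrt p.2)).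
Proof.
move=> p0; apply: continuous_cvg (cont_ratio p0).
exact: is_derive_continuous (is_derive_erf _).
Qed.

Let cont_gauss_ratio p : 0 < p.2 ->
  gauss_fun (q.1 / (2 * Num.sqrt q.2)) @[q --> p]
    --> gauss_fun (p.1 / (2 * Num.sqrt p.2)).
Proof.
move=> p0; apply: continuous_cvg (cont_ratio p0).
exact: continuous_gauss_fun.
Qed.

Lemma continuous_profile p : 0 < p.2 ->
  {for p, continuous (fun q => profile nu a q.1 q.2)}.
Proof.
move=> p0; apply: cvgD; apply: cvgM; try exact: cvg_cst; last exact: cont_fst.
apply: cvgD; apply: cvgM; try exact: cont_erf_ratio; try exact: cont_gauss_ratio.
- apply: cvgD; last by apply: cvgM; [exact: cvg_cst|exact: cont_snd].
  exact: cont_fst_sqr.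
- apply: cvgM; first exact: cvg_cst.
  by apply: cvgM; [exact: cont_fst|exact: cont_sqrt].
Qed.

Lemma continuous_profile_x p : 0 < p.2 ->
  {for p, continuous (fun q => profile_x nu a q.1 q.2)}.
Proof.
move=> p0; apply: cvgD; last exact: cvg_cst.
apply: cvgM; first exact: cvg_cst.
apply: cvgD; apply: cvgM; try exact: cont_erf_ratio; try exact: cont_gauss_ratio.
- exact: cont_fst.
- by apply: cvgM; [exact: cvg_cst|exact: cont_sqrt].
Qed.

Lemma continuous_profile_xx p : 0 < p.2 ->
  {for p, continuous (fun q => profile_xx nu q.1 q.2)}.
Proof. by move=> p0; apply: cvgM; [exact: cvg_cst|exact: cont_erf_ratio]. Qed.

Let near_pos t : 0 < t -> \forall s \near t, 0 < s.
Proof. exact: lt_nbhsr. Qed.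

Let cont_green_pos p : 0 < p.2 ->
  {for p, continuous (fun q => green_solution h q.1 q.2)}.
Proof.
move=> p0; rewrite /prop_for /continuous_at (green_profile hE)//.
apply: cvg_trans (continuous_profile p0); apply: near_eq_cvg.
have : \forall q \near p, 0 < q.2 by exact: (cont_snd (near_pos p0)).
by apply: filterS => q q0; rewrite (green_profile hE).
Qed.

Let cont_green_init x0 : 0 < x0 ->
  {for (x0, 0), continuous (fun q => green_solution h q.1 q.2)}.
Proof.
move=> x00.
(* Setting erf = 1, gauss = 0 and t = 0 when t <= 0 makes one formula cover both
   branches of [green_solution] near (x0, 0), with factors continuous there. *)
pose e (q : R * R) : R := if 0 < q.2 then erf (q.1 / (2 * Num.sqrt q.2)) else 1.
pose g (q : R * R) : R := if 0 < q.2 then gauss_fun (q.1 / (2 * Num.sqrt q.2)) else 0.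
pose w (q : R * R) : R := if 0 < q.2 then q.2 else 0.
(* Near (x0, 0), x exceeds 2 M sqrt t, hence the argument of erf exceeds M. *)
have e1 : e q @[q --> (x0, 0)] --> (1 : R).
  apply/cvgrPdist_lt => eps eps0.
  have /cvgrPdist_lt/(_ eps eps0)[M [Mr HM]] := @cvg_erfy R.
  have : \forall q \near (x0, 0 : R), 0 < q.1 - M * (2 * Num.sqrt q.2).
    have C : q.1 - M * (2 * Num.sqrt q.2) @[q --> (x0, 0 : R)] -->
        x0 - M * (2 * Num.sqrt 0).
      apply: cvgB; first exact: cont_fst.
      apply: cvgM; first exact: cvg_cst.
      by apply: cvgM; [exact: cvg_cst|exact: cont_sqrt].
    have L : 0 < x0 - M * (2 * Num.sqrt 0) by rewrite sqrtr0 !mulr0 subr0.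
    exact: (C _ (near_pos L)).
  apply: filterS => q; rewrite subr_gt0 => qM; rewrite /e; case: ifPn => q2.
    by apply: HM => /=; rewrite ltr_pdivlMr// mulr_gt0// sqrtr_gt0.
  by rewrite subrr normr0.
have w0 : w q @[q --> (x0, 0)] --> (0 : R).
  have N : `|q.2| @[q --> (x0, 0 : R)] --> (0 : R).
    by rewrite -[X in _ --> X](normr0 R); apply: cvg_norm; exact: cont_snd.
  apply: (squeeze_cvgr _ (cvg_cst 0) N); apply: nearW => q /=.
  by rewrite /w; case: ifPn => q2; rewrite ?lexx ?normr_ge0 ?(ltW q2) ?ler_norm.
(* The bound 0 <= [g] <= 1 suffices, since x sqrt(t) already tends to 0. *)
have xg0 : q.1 * Num.sqrt q.2 * g q @[q --> (x0, 0)] --> (0 : R).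
  have N : `|q.1 * Num.sqrt q.2| @[q --> (x0, 0 : R)] --> (0 : R).
    rewrite -[X in _ --> X](normr0 R) -[X in `|X|](mulr0 x0) -[X in _ * X]sqrtr0.
    by apply: cvg_norm; apply: cvgM; [exact: cont_fst|exact: cont_sqrt].
  apply: norm_cvg0; apply: (squeeze_cvgr _ (cvg_cst 0) N); apply: nearW => q /=.
  rewrite normr_ge0 /= normrM ler_piMr//.
  by rewrite /g; case: ifPn => q2;
    rewrite ?normr0// ger0_norm ?gauss_fun_ge0 ?gauss_fun_le1.
have lim : nu / 2 * ((q.1 ^+ 2 + 2 * w q) * e q
      + 2 / Num.sqrt pi * (q.1 * Num.sqrt q.2 * g q)) + a * q.1
    @[q --> (x0, 0 : R)] -->
    nu / 2 * ((x0 ^+ 2 + 2 * 0) * 1 + 2 / Num.sqrt pi * 0) + a * x0.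
  apply: cvgD; apply: cvgM; try exact: cvg_cst; last exact: cont_fst.
  apply: cvgD; apply: cvgM => //; try exact: cvg_cst.
  apply: cvgD; last by apply: cvgM => //; exact: cvg_cst.
  exact: cont_fst_sqr.
rewrite /prop_for /continuous_at /green_solution ltxx hE ?(ltW x00)//.
rewrite !mulr0 !addr0 mulr1 in lim.
apply: cvg_trans lim; apply: near_eq_cvg.
have : \forall q \near (x0, 0 : R), 0 < q.1.
  by exact: (@cont_fst (x0, 0) _ (near_pos x00)).
apply: filterS => q q1; rewrite /e /g /w; case: ifPn => q2.
  by have := green_profile hE q.1 q2; rewrite /green_solution q2 => ->;
    rewrite /profile !mulrA.
by rewrite hE ?(ltW q1)// !mulr0 !addr0 mulr1.
Qed.

Lemma green_solution_P0 : solution_P0 h (green_solution h).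
Proof.
have Ex t : 0 < t -> green_solution h ^~ t = profile nu a ^~ t.
  by move=> t0; apply/funext => x; exact: green_profile.
have Dx x t : 0 < t ->
    is_derive x 1 (green_solution h ^~ t) (profile_x nu a x t).
  by move=> t0; rewrite (Ex t t0); exact: (is_derive_profile_x nu a x t0).
have Et t : 0 < t -> d_x (green_solution h) ^~ t = profile_x nu a ^~ t.
  by move=> t0; apply/funext => x; rewrite /d_x derive1E; apply: derive_val; exact: Dx.
have Dxx x t : 0 < t ->
    is_derive x 1 (d_x (green_solution h) ^~ t) (profile_xx nu x t).
  by move=> t0; rewrite (Et t t0); exact: (is_derive_profile_xx nu a x t0).
have Exx x t : 0 < t -> d_xx (green_solution h) x t = profile_xx nu x t.
  by move=> t0; rewrite /d_xx derive1E; apply: derive_val; exact: Dxx.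
have Dt x t : 0 < t -> is_derive t 1 (green_solution h x) (profile_xx nu x t).
  (* The closed form holds for positive times, thus in a neighbourhood of [t], which is enough for
     the derivative. *)
  move=> t0; apply: near_eq_is_derive (is_derive_profile_t nu a x t0).
  by apply: filterS (near_pos t0) => s s0; rewrite (green_profile hE).
have Edt x t : 0 < t -> d_t (green_solution h) x t = profile_xx nu x t.
  by move=> t0; rewrite /d_t derive1E; apply: derive_val; exact: Dt.
split.
- apply: continuous_in_subspaceT => -[x t]; rewrite inE => -[/= x0 t0 xt0].
  (* For t > 0 the closed form is continuous across x = 0, so the lateral boundary is included here;
     at t = 0 the removal of the corner leaves x > 0. *)
  have [t_gt0|t_le0] := ltP 0 t; first exact: cont_green_pos.
  have t_eq0 : t = 0 by apply/eqP; rewrite eq_le t_le0.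
  move: xt0; rewrite t_eq0 => xt0; apply: cont_green_init.
  by rewrite lt_neqAle x0 andbT eq_sym; apply: contraNneq xt0 => ->.
- by move=> x t _ t0; case: (Dt x t t0).
- by move=> x t _ t0; case: (Dx x t t0).
- by move=> x t _ t0; case: (Dxx x t t0).
- apply: (@within_continuous_eq_in _ _ _ (fun p => profile_xx nu p.1 p.2)) => p [_ p2].
    by rewrite Edt.
  exact: continuous_profile_xx.
- apply: (@within_continuous_eq_in _ _ _ (fun p => profile_x nu a p.1 p.2)) => p [_ p2].
    by rewrite -[RHS]/((d_x _ ^~ p.2) p.1) Et.
  exact: continuous_profile_x.
- apply: (@within_continuous_eq_in _ _ _ (fun p => profile_xx nu p.1 p.2)) => p [_ p2].
    by rewrite Exx.
  exact: continuous_profile_xx.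
- by move=> x t _ t0; rewrite Edt// Exx// subrr.
- by move=> x _; rewrite /green_solution ltxx.
- by move=> t t0; rewrite (green_profile hE)// /profile mul0r erf0;
    rewrite !(mulr0, mul0r) !addr0 mulr0.
Qed.

(** Once sqrt(t) >= x, the bracket multiplied by nu / 2 is at least x sqrt(t / pi): the [erf] term
    is nonnegative and the Gaussian is at least 1/2. The other term, a x, is constant in time. *)
Lemma cvgy_green_solution x : nu != 0 -> 0 < x ->
  `|green_solution h x t| @[t --> +oo] --> +oo.
Proof.
move=> nu0 x0; apply/cvgryPge => M.
have c_gt0 : 0 < `|nu| / 2 * (x / Num.sqrt pi).
  by rewrite !mulr_gt0 ?invr_gt0 ?normr_gt0// sqrtpi_gt0.
(* A threshold for sqrt(t): the first entry gives x <= sqrt(t), the second makes the lower bound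
   exceed [M] even after [a * x] is subtracted in absolute value. *)
pose B := Num.max x ((`|M| + `|a * x|) / (`|nu| / 2 * (x / Num.sqrt pi))).
have B0 : 0 < B by rewrite lt_max x0.
near=> t.
have tB : B ^+ 2 <= t by near: t; apply: nbhs_pinfty_ge; exact: num_real.
have t0 : 0 < t by apply: lt_le_trans tB; rewrite exprn_gt0.
have s0 : 0 < Num.sqrt t by rewrite sqrtr_gt0.
have sB : B <= Num.sqrt t.
  by rewrite -(ger0_norm (ltW B0)) -sqrtr_sqr ler_wsqrtr.
have [xs Ms] : x <= Num.sqrt t /\
    `|M| + `|a * x| <= `|nu| / 2 * (x / Num.sqrt pi) * Num.sqrt t.
  split; first by apply: le_trans sB; rewrite le_max lexx.
  by rewrite [leRHS]mulrC -ler_pdivrMr//; apply: le_trans sB; rewrite le_max lexx orbT.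
have y1 : x / (2 * Num.sqrt t) <= 1 / 2.
  by rewrite ler_pdivrMr ?mulr_gt0// mulrA mul1r mulVf// mul1r.
have y0 : 0 <= x / (2 * Num.sqrt t) by rewrite divr_ge0 ?mulr_ge0 ?ltW.
have g2 : 1 / 2 <= gauss_fun (x / (2 * Num.sqrt t)).
  (* With y <= 1/2, exp(-y^2) >= 1 - y^2 >= 3/4. *)
  by apply: le_trans (expR_ge1Dx _); nra.
rewrite (green_profile hE)// /profile.
set E := (_ + 2 / _ * _ * _).
have EB : x / Num.sqrt pi * Num.sqrt t <= E.
  rewrite /E -[leLHS]add0r lerD//.
    rewrite mulr_ge0 ?erf_ge0// addr_ge0 ?sqr_ge0//.
    by rewrite mulr_ge0// ltW.
  have -> : x / Num.sqrt pi * Num.sqrt t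
      = 2 / Num.sqrt pi * (x * Num.sqrt t) * (1 / 2) by field; rewrite gt_eqF ?sqrtpi_gt0.
  rewrite ler_wpM2l// mulr_ge0 ?divr_ge0 ?sqrtr_ge0//.
  by rewrite mulr_ge0 ?ltW.
have E0 : 0 <= E.
  by apply: le_trans EB; rewrite mulr_ge0 ?sqrtr_ge0// divr_ge0 ?sqrtr_ge0// ltW.
apply: le_trans (lerB_normD _ _); rewrite lerBrDr.
apply: le_trans (lerD (ler_norm M) (lexx _)) _; apply: le_trans Ms _.
rewrite normrM (ger0_norm E0) normrM (ger0_norm (x := 2^-1))// -mulrA.
by rewrite ler_wpM2l.
Unshelve. all: by end_near. Qed.

End QuadraticSolution.

(** The polynomial has u_t = 0 and u_xx = nu, which balances the source -nu. *)
Lemma stationary_solution_P {R : realType} (nu a : R) (Phi F h : R -> R) :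
  (forall x, 0 < x -> Phi x = 1) -> (forall V, F V = nu) ->
  (forall x, 0 <= x -> h x = nu / 2 * x ^+ 2 + a * x) ->
  solution_P Phi F h (fun x _ => nu / 2 * x ^+ 2 + a * x).
Proof.
move=> PhiE FE hE; set u := fun x (_ : R) => _ : R.
have D1 (x t : R) : is_derive x 1 (u ^~ t) (nu * x + a).
  apply: (is_derive_eq (is_derive_add
    (is_derive_mul (is_derive_const (nu / 2) _) (is_derive_sqr x))
    (is_derive_mul (is_derive_const a _) (is_derive_var x)))).
  by field.
have E1 : d_x u = fun x _ => nu * x + a.
  apply/funext => x; apply/funext => t; rewrite /d_x derive1E.
  exact: (@derive_val _ _ _ _ _ _ _ (D1 x t)).
have D2 (x t : R) : is_derive x 1 (d_x u ^~ t) nu.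
  rewrite E1; apply: (is_derive_eq (is_derive_add
    (is_derive_mul (is_derive_const nu _) (is_derive_var x)) (is_derive_const a _))).
  by ring.
have E2 : d_xx u = fun _ _ => nu.
  apply/funext => x; apply/funext => t; rewrite /d_xx derive1E.
  exact: (@derive_val _ _ _ _ _ _ _ (D2 x t)).
have D0 (x t : R) : is_derive t 1 (u x) 0 by exact: is_derive_const.
have E0 : d_t u = fun _ _ => 0.
  apply/funext => x; apply/funext => t; rewrite /d_t derive1E.
  exact: (@derive_val _ _ _ _ _ _ _ (D0 x t)).
have cfst (p : R * R) : q.1 @[q --> p] --> p.1 by exact: cvg_fst.
have caff (p : R * R) : nu * q.1 + a @[q --> p] --> nu * p.1 + a.
  by apply: cvgD; [apply: cvgM; [exact: cvg_cst|exact: cfst]|exact: cvg_cst].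
split.
  (* For x != 0 the quotient is nu/2 x + a, so the flux is [a]; the witness keeps the unsimplified
     form produced by the limit rules. *)
  move=> t t0; apply/cvg_ex; exists (nu / 2 * 0 + a).
  have : nu / 2 * x + a @[x --> 0^'+] --> nu / 2 * 0 + a.
    apply: cvg_at_right_filter.
    by apply: cvgD; [apply: cvgM; [exact: cvg_cst|exact: cvg_id]|exact: cvg_cst].
  apply: cvg_trans; apply: near_eq_cvg; near=> x.
  have x0 : x != 0 by rewrite gt_eqF//; near: x; exact: nbhs_right_gt.
  by rewrite /boundary_flux_quotient /u; field.
split.
- apply: continuous_subspaceT => p.
  have -> : (fun q : R * R => u q.1 q.2) = (fun q => q.1 * (nu / 2 * q.1 + a)).
    by apply/funext => q; rewrite /u; ring.
  apply: cvgM; first exact: cfst.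
  by apply: cvgD; [apply: cvgM; [exact: cvg_cst|exact: cfst]|exact: cvg_cst].
- by move=> x t _ _; case: (D0 x t).
- by move=> x t _ _; case: (D1 x t).
- by move=> x t _ _; case: (D2 x t).
- by rewrite E0; apply: continuous_subspaceT => p; exact: cvg_cst.
- by rewrite E1; apply: continuous_subspaceT => p; exact: caff.
- by rewrite E2; apply: continuous_subspaceT => p; exact: cvg_cst.
- by move=> x t x0 _; rewrite E0 E2 PhiE// FE; ring.
- by move=> x x0; rewrite hE// ltW.
- by move=> t _; rewrite /u; ring.
Unshelve. all: by end_near. Qed.

Theorem theorem3p1 (R : realType) (nu a : R) (Phi F h : R -> R)
  (hnu : nu != 0)
  (hPhi : forall x : R, 0 < x -> Phi x = 1)
  (hF : forall V : R, F V = nu)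
  (hh : forall x : R, 0 <= x -> h x = nu / 2 * x ^+ 2 + a * x) :
  [/\ (forall x t : R, 0 <= x -> 0 < t ->
         (@lebesgue_measure R).-integrable `[0, +oo[
           (fun xi => (G x t xi 0 * h xi)%:E)),
      solution_P0 h (green_solution h),
      (forall x : R, 0 < x ->
         `|green_solution h x t| @[t --> +oo] --> +oo)
    & exists u : R -> R -> R,
        solution_P Phi F h u /\
        (forall x : R, 0 < x -> u x t @[t --> +oo] --> h x)].
Proof.
split.
- by move=> x t x0 t0; exact: integrable_green hh _ _ x0 t0.
- exact: green_solution_P0 hh.
- by move=> x x0; exact: cvgy_green_solution hh _ hnu x0.
(* The polynomial is taken instead of [h], whose values are prescribed for x >= 0 only; the limit in
   time is then that of a constant. *)
- exists (fun x _ => nu / 2 * x ^+ 2 + a * x); split.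
    exact: stationary_solution_P.
  by move=> x x0; rewrite hh ?(ltW x0)//; exact: cvg_cst.
Qed.
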